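(* Let $k \ge 1$, $\ell \ge 0$ and $t \ge 2$ be integers, and suppose $n \ge n_0(k,\ell)$, where $n_0(k,\ell)$ is a sufficiently large integer depending only on $k$ and $\ell$, and $$\binom{n}{k} - \binom{n-\ell}{k} \le m \le \binom{n}{k} - \binom{n-\ell-1}{k}.$$ If $\mathcal{F}$ is a $k$-uniform set family on $[n]$ of size $m$ maximising the number $\mathrm{int}(\mathcal{F},t)$ of intersecting subfamilies of size $t$ (among all $k$-uniform families on $[n]$ of size $m$), then either (i) $\mathcal{F}$ contains $\ell$ full stars, i.e. there are $\ell$ distinct elements $i \in [n]$ such that $\mathcal{F}$ contains every $k$-subset of $[n]$ containing $i$; or (ii) $\mathcal{F}$ consists of $\ell+1$ almost-full stars, i.e. there are $\ell+1$ distinct elements of $[n]$, each contained in at least $(1-\delta(n))\binom{n-1}{k-1}$ sets of $\mathcal{F}$, such that every set of $\mathcal{F}$ contains at least one of these $\ell+1$ elements. Here $\delta = \delta_{k,\ell}$ is a nonnegative function depending only on $k$ and $\ell$ with $\delta(n) \to 0$ as $n \to \infty$.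
   Context: $[n]=\{1,\dots,n\}$, and a $k$-uniform set family on $[n]$ is a collection of $k$-element subsets of $[n]$. A family $\mathcal{G}$ of sets is intersecting if $G_1 \cap G_2 \ne \emptyset$ for all $G_1, G_2 \in \mathcal{G}$. $\mathrm{int}(\mathcal{F},t)$ is the number of subfamilies of $\mathcal{F}$ consisting of exactly $t$ sets that are intersecting. A star is a family of sets all containing a common element (its centre). A star in $\mathcal{F}$ is full if it contains $\binom{n-1}{k-1}$ sets, and almost full if it has $(1-o(1))\binom{n-1}{k-1}$ sets, where asymptotic notation is for $n \to \infty$ with $k,\ell$ fixed, with no assumption on the relative magnitudes of $n$ and $t$.
   Formalization: For k ≥ 2 and ℓ ≥ 1 it is also assumed that t ≤ C(n−1,k−1); otherwise, for large n, int(F,t)=0 for every F, so every family is a maximiser and the claim fails (e.g. k=2, ℓ=1, m=n−1, t=n, F the edges of a path). *)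

(* Defs.v *)
From mathcomp Require Import all_boot all_order ssralg ssrnum.
From mathcomp Require Import reals.

Set Implicit Arguments.
Unset Strict Implicit.
Unset Printing Implicit Defensive.

Import GRing.Theory Num.Theory.

(* The ground set [n] is 'I_n; a set family on it is a {set {set 'I_n}}. *)

Definition uniform (n k : nat) (F : {set {set 'I_n}}) : Prop :=
  forall A, A \in F -> #|A| = k.

(* The case A = B makes every family with the empty set as a member not
   intersecting. *)
Definition intersecting (n : nat) (G : {set {set 'I_n}}) : bool :=
  [forall A in G, forall B in G, A :&: B != set0].

Definition num_int (n : nat) (F : {set {set 'I_n}}) (t : nat) : nat :=
  #|[set G : {set {set 'I_n}} | [&& G \subset F, #|G| == t & intersecting G]]|.

Definition maximises_int (n k m t : nat) (F : {set {set 'I_n}}) : Prop :=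
  [/\ uniform k F, #|F| = m &
      forall G : {set {set 'I_n}}, uniform k G -> #|G| = m -> num_int G t <= num_int F t].

Definition star (n : nat) (F : {set {set 'I_n}}) (i : 'I_n) : {set {set 'I_n}} :=
  [set A in F | i \in A].

Definition full_star (n k : nat) (F : {set {set 'I_n}}) (i : 'I_n) : Prop :=
  forall A : {set 'I_n}, #|A| = k -> i \in A -> A \in F.

Definition almost_full_star (R : realType) (delta : R) (n k : nat)
    (F : {set {set 'I_n}}) (i : 'I_n) : Prop :=
  ((1 - delta) * 'C(n.-1, k.-1)%:R <= #|star F i|%:R)%R.

(* Main.v *)
Require Import Defs.
From mathcomp Require Import all_boot all_order ssralg ssrnum.
From mathcomp Require Import classical_sets reals topology normedtype sequences.
From mathcomp Require Import zify fintype finset.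

Set Implicit Arguments.
Unset Strict Implicit.
Unset Printing Implicit Defensive.

Import Order.TTheory GRing.Theory Num.Theory.
Import numFieldNormedType.Exports.

(** The cases k = 1 and l = 0 are immediate. For k >= 2 and l >= 1 put
    N = C(n-1,k-1), the size of a full star, and L = C(n-2,k-2), the number of
    k-sets through two given points; (n-1) L = (k-1) N, so L / N = O(1/n). Write
    d(x) for the number of members of F through x.

    The whole argument consists of exchanges: remove some members A of F, add
    as many k-sets through a chosen centre i, and use that the number of
    intersecting t-subfamilies cannot grow ([exchange]). Adding a sets to the
    star of i creates at least C(d(i)+a, t) - C(d(i), t) new subfamilies. What is
    lost are the subfamilies meeting the removed part; such a subfamily either
    lies in a star or is spread (has no common point). Spread subfamilies are
    negligible, uniformly in t: after fixing at most three of their members, all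
    the others meet a bounded set of points at least twice, so that only O(L)
    sets are available ([card_spread], [spread_bound_small]). The constants do not
    depend on t because everything is compared with C(D, t-1) for some D of
    order N, through C(d,s)/d being monotone in d.

    If F has at least l full stars there is nothing to prove. Otherwise let i be
    a centre of maximal degree D among the centres of non-full stars.
    - Filling up the star of i at the expense of sets that avoid i and all full
      centres is possible because of the lower bound on m; it shows that D is
      at least a constant fraction of N ([max_degree_large]).
    - Call x heavy if d(x) is at least D / 2k. Exchanging a single set shows that
      each member of F contains a heavy point ([heavy_cover]). As the degrees
      sum up to k m, there are boundedly many heavy points, and then the degree
      of a point that is not heavy is O(L) ([card_heavy], [light_star]).
    - Let j be heavy, j <> i, with a non-full star. Exchanging one set
      shows d(j) >= D - O(L), since otherwise the gain C(D, t-1) exceeds the loss.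
      Exchanging 2b sets with b a large multiple of L brings in the
      convexity of C(_, t): making two stars of nearly equal size unequal is
      profitable, unless there is no room for it. Hence D >= N - O(L)
      ([heavy_near]).
    Now count the heavy points. If there are at most l, F is covered by
    an l-set, all of whose stars are full by the lower bound on m. If there are l+1 or more, at
    least one of them besides i has a non-full star, so that all of them have
    degree N - O(L); l+2 of them would force m > (l+1) N ([structure]).
    So there are l+1, and delta(n) = O(L/N) = O(1/n). *)

(** * Counting families of sets *)

Lemma subset_of_card (T : finType) (S : {set T}) (a : nat) :
  a <= #|S| -> exists2 P : {set T}, P \subset S & #|P| = a.
Proof.
rewrite -bin_gt0 -cards_draws card_gt0 => /set0Pn[P].
by rewrite inE => /andP[sPS /eqP]; exists P.
Qed.

Lemma card_between (T : finType) (P S : {set T}) (t : nat) :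
  #|[set G : {set T} | [&& P \subset G, G \subset S & #|G| == t]]|
    <= 'C(#|S| - #|P|, t - #|P|).
Proof.
set E := [set G : {set T} | _].
have [->|[G0]] := set_0Vmem E; first by rewrite cards0.
rewrite inE => /and3P[PG0 G0S _].
rewrite -(cardsDS (subset_trans PG0 G0S)) -cards_draws.
have inj : {in E &, injective (fun G : {set T} => G :\: P)}.
  move=> G H; rewrite !inE => /and3P[PG _ _] /and3P[PH _ _] eqGH.
  by rewrite -(setID G P) -(setID H P) eqGH (setIidPr PG) (setIidPr PH).
rewrite -(card_in_imset inj); apply/subset_leq_card/subsetP => _ /imsetP[G GE ->].
move: GE; rewrite !inE => /and3P[PG GS /eqP cG].
by rewrite setSD //= cardsDS // cG.
Qed.

Lemma leq_card_bigcup_sum (T I : finType) (P : {set I}) (B : I -> {set T}) :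
  #|\bigcup_(i in P) B i| <= \sum_(i in P) #|B i|.
Proof.
elim/big_ind2: _ => [|A m C p leA leC|//]; first by rewrite cards0.
by rewrite (leq_trans (leq_card_setU _ _).1) ?leq_add.
Qed.

Lemma leq_card_bigcup (T I : finType) (P : {set I}) (B : I -> {set T}) (p b : nat) :
  #|P| <= p -> (forall i, i \in P -> #|B i| <= b) ->
  #|\bigcup_(i in P) B i| <= p * b.
Proof.
move=> leP leB; apply: leq_trans (leq_card_bigcup_sum _ _) _.
by apply: (@leq_trans (#|P| * b)); rewrite ?leq_mul2r ?leP ?orbT // -sum_nat_const leq_sum.
Qed.

(** * Binomial inequalities *)

(** Division-free form of the monotonicity in d of C(d,s)/d; the next lemma is
    the same for C(d,s)/d^2. *)
Lemma bin_scale (d D s : nat) : 0 < s -> d <= D -> 'C(d, s) * D <= d * 'C(D, s).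
Proof.
case: s => // s _; case: d D => [|d] [|D] //; rewrite ltnS => dD.
have Ed := mul_bin_diag d.+1 s; have ED := mul_bin_diag D.+1 s.
rewrite -(leq_pmul2l (ltn0Sn s)) mulnA -Ed mulnCA -ED /=.
by rewrite mulnAC mulnA leq_mul2l leq_bin2l ?orbT.
Qed.

Lemma bin_scale2 (d D s : nat) : 1 < s -> d <= D ->
  'C(d, s) * D ^ 2 <= d ^ 2 * 'C(D, s).
Proof.
case: s => [|s] //; case: d D => [|d] [|D] //; rewrite !ltnS => s0 dD.
have Ed := mul_bin_diag d.+1 s; have ED := mul_bin_diag D.+1 s.
have H := bin_scale s0 dD.
rewrite -(leq_pmul2l (ltn0Sn s)) mulnA -Ed mulnCA -ED /=.
rewrite (_ : _ * _ * _ = (d.+1 * D.+1) * ('C(d, s) * D.+1)); last by nia.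
rewrite (_ : d.+1 ^ 2 * _ = (d.+1 * D.+1) * (d.+1 * 'C(D, s))); last by nia.
by rewrite leq_mul2l; apply/orP; right; have := leq_bin2l s dD; nia.
Qed.

(** One term of the Vandermonde convolution. *)
Lemma leq_mul_bin (a b r s : nat) : 'C(a, r) * 'C(b, s) <= 'C(a + b, r + s).
Proof.
have rP : r < (r + s).+1 by lia.
rewrite -Vandermonde (bigD1 (Ordinal rP)) //=.
by rewrite (_ : r + s - r = s) ?leq_addr //; lia.
Qed.

Lemma bin2_ge (x : nat) : 1 < x -> x ^ 2 <= 4 * 'C(x, 2).
Proof.
move=> x1; have := mul_bin_diag x 1; rewrite bin1.
by case: x x1 => [|[|x]] //= _; nia.
Qed.

(** By Pascal's rule each unit step from d to d + a adds at least C(d,s). *)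
Lemma bin_addS_ge (d a s : nat) : 'C(d, s.+1) + a * 'C(d, s) <= 'C(d + a, s.+1).
Proof.
elim: a => [|a IH]; first by rewrite addn0 addn0.
by rewrite addnS binS mulSn; have := leq_bin2l s (leq_addr a d); lia.
Qed.

Lemma bin_sub_le (n k r : nat) : 'C(n, k.+1) - 'C(n - r, k.+1) <= r * 'C(n.-1, k).
Proof.
elim: r => [|r IH]; first by rewrite subn0 subnn.
have: 'C(n - r, k.+1) <= 'C(n - r.+1, k.+1) + 'C(n.-1, k).
  have [nr|nr] := leqP n r; first by rewrite (_ : n - r = 0) ?bin0n//; lia.
  rewrite (_ : n - r = (n - r.+1).+1) ?binS ?leq_add2l ?leq_bin2l //; lia.
by rewrite mulSn; lia.
Qed.

(** * Stars and degrees *)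

Definition hitting (n k : nat) (S : {set 'I_n}) : {set {set 'I_n}} :=
  [set A : {set 'I_n} | (#|A| == k) && (A :&: S != set0)].

(** The source of all error terms: for a bounded set U of points there are only
    O(n^(k-2)) of these sets, against n^(k-1) for a star. *)
Definition multimeet (n k : nat) (U : {set 'I_n}) : {set {set 'I_n}} :=
  [set A : {set 'I_n} | (#|A| == k) && (1 < #|A :&: U|)].

Lemma card_hitting (n k : nat) (S : {set 'I_n}) :
  #|hitting k S| = 'C(n, k) - 'C(n - #|S|, k).
Proof.
have cT : #|[set A : {set 'I_n} | #|A| == k]| = 'C(n, k).
  by rewrite -[n in RHS]card_ord -cardsT -cards_draws; apply: eq_card => A;
    rewrite !inE subsetT.
have cC : #|[set A : {set 'I_n} | (A \subset ~: S) && (#|A| == k)]| = 'C(n - #|S|, k).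
  by rewrite cards_draws cardsCs setCK card_ord.
rewrite -cT -cC -(cardsID (hitting k S) [set A : {set 'I_n} | #|A| == k]).
rewrite (_ : _ :&: _ = hitting k S); last first.
  by apply/setP => A; rewrite !inE; case: eqP.
rewrite (_ : _ :\: _ = [set A : {set 'I_n} | (A \subset ~: S) && (#|A| == k)]) ?addnK //.
apply/setP => A; rewrite !inE -disjoints_subset -setI_eq0.
by case: eqP; rewrite ?andbT ?andbF // negbK.
Qed.

Lemma card_hitting1 (n k : nat) (i : 'I_n) :
  0 < k -> #|hitting k [set i]| = 'C(n.-1, k.-1).
Proof.
move=> k0; rewrite card_hitting cards1 -(prednK k0).
by case: n i => [[]//|n] _; rewrite subn1 /= binS addKn.
Qed.

Lemma hitting1E (n k : nat) (i : 'I_n) (A : {set 'I_n}) :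
  (A \in hitting k [set i]) = (#|A| == k) && (i \in A).
Proof.
rewrite inE; congr (_ && _); apply/set0Pn/idP => [[x]|iA].
  by rewrite !inE => /andP[xA /eqP <-].
by exists i; rewrite !inE iA eqxx.
Qed.

Lemma star_sub_hitting (n k : nat) (F : {set {set 'I_n}}) (i : 'I_n) :
  uniform k F -> star F i \subset hitting k [set i].
Proof.
by move=> uF; apply/subsetP => A; rewrite hitting1E inE => /andP[/uF/eqP-> ->].
Qed.

Lemma card_star_le (n k : nat) (F : {set {set 'I_n}}) (i : 'I_n) :
  0 < k -> uniform k F -> #|star F i| <= 'C(n.-1, k.-1).
Proof.
by move=> k0 uF; rewrite -(card_hitting1 i k0) subset_leq_card ?star_sub_hitting.
Qed.

Lemma full_starP (n k : nat) (F : {set {set 'I_n}}) (i : 'I_n) :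
  0 < k -> uniform k F -> #|star F i| = 'C(n.-1, k.-1) -> full_star k F i.
Proof.
move=> k0 uF eqN A /eqP cA iA.
have /eqP E : star F i == hitting k [set i].
  by rewrite eqEcard star_sub_hitting //= card_hitting1 // eqN.
have : A \in star F i by rewrite E hitting1E cA.
by rewrite inE => /andP[].
Qed.

Lemma card_multimeet (n k : nat) (U : {set 'I_n}) :
  #|multimeet k U| <= #|U| ^ 2 * 'C(n - 2, k - 2).
Proof.
pose P := [set p in setX U U | p.1 != p.2].
pose B (p : 'I_n * 'I_n) := [set A : {set 'I_n} |
  [&& [set p.1; p.2] \subset A, A \subset setT & #|A| == k]].
have cP : #|P| <= #|U| ^ 2.
  rewrite -mulnn -cardsX; apply/subset_leq_card/subsetP => p.
  by rewrite !inE => /andP[].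
apply: (@leq_trans #|\bigcup_(p in P) B p|).
  apply/subset_leq_card/subsetP => A; rewrite inE => /andP[cA /card_gt1P[x [y [xA yA xy]]]].
  move: xA yA; rewrite !inE => /andP[xA xU] /andP[yA yU].
  apply/bigcupP; exists (x, y); rewrite !inE /= ?xU ?yU // cA subsetT !andbT.
  by apply/subsetP => z; rewrite !inE => /orP[]/eqP->.
apply: leq_card_bigcup cP _ => p; rewrite inE => /andP[_ np].
by apply: leq_trans (card_between _ _ _) _; rewrite cardsT card_ord cards2 np.
Qed.

Lemma sum_card_star (n : nat) (F : {set {set 'I_n}}) (Y : {set 'I_n}) :
  \sum_(x in Y) #|star F x| = \sum_(A in F) #|A :&: Y|.
Proof.
transitivity (\sum_(x in Y) \sum_(A in F) (x \in A : nat)).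
  apply: eq_bigr => x _; rewrite -sum1_card (eq_bigl (fun A => (A \in F) && (x \in A))).
    by rewrite big_mkcondr; apply: eq_bigr => A _; case: (x \in A).
  by move=> A; rewrite inE.
rewrite exchange_big; apply: eq_bigr => A _ /=.
rewrite -sum1_card (eq_bigl (fun x => (x \in Y) && (x \in A))).
  by rewrite big_mkcondr; apply: eq_bigr => x _; case: (x \in A).
by move=> x; rewrite !inE andbC.
Qed.

Lemma sum_star (n k : nat) (F : {set {set 'I_n}}) :
  uniform k F -> \sum_x #|star F x| = k * #|F|.
Proof.
move=> uF; rewrite (eq_bigl (fun x => x \in setT)) => [|x]; last by rewrite inE.
rewrite sum_card_star -[RHS]mulnC -sum_nat_const.
by apply: eq_bigr => A /uF <-; rewrite setIT.
Qed.

(** A member of F that is counted more than once on the left lies in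
    [multimeet k Y], and it is counted at most k times. *)
Lemma sum_star_le (n k : nat) (F : {set {set 'I_n}}) (Y : {set 'I_n}) :
  uniform k F ->
  \sum_(x in Y) #|star F x| <= #|F| + k * (#|Y| ^ 2 * 'C(n - 2, k - 2)).
Proof.
move=> uF; rewrite sum_card_star.
apply: (@leq_trans (\sum_(A in F) (1 + k * (A \in multimeet k Y)))).
  apply: leq_sum => A /uF cA; rewrite inE cA eqxx /=.
  have : #|A :&: Y| <= k by rewrite -cA subset_leq_card ?subsetIl.
  by case: ltnP => [_ le_k|le_1 _]; rewrite ?muln1 ?muln0 ?(leq_trans le_k) ?leq_addl.
rewrite big_split /= sum1_card leq_add2l -big_distrr /= leq_mul2l; apply/orP; right.
apply: leq_trans (card_multimeet k Y); rewrite -big_mkcondr /= sum1_card.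
by apply/subset_leq_card/subsetP => A /andP[].
Qed.

(** * The exchange inequality *)

Definition intfam (n : nat) (F : {set {set 'I_n}}) (t : nat) : {set {set {set 'I_n}}} :=
  [set G : {set {set 'I_n}} | [&& G \subset F, #|G| == t & intersecting G]].

(** Replace cA by equally many k-sets through i that are missing from F; there is
    room for them. Subfamilies that avoid cA survive. Among the subfamilies of
    the enlarged star, all of which are intersecting, those that were already
    there number at most C(d(i), t). *)
Lemma exchange (n k m t : nat) (F cA : {set {set 'I_n}}) (i : 'I_n) :
  0 < k -> maximises_int k m t F -> cA \subset F ->
  (forall A, A \in cA -> i \notin A) ->
  #|cA| + #|star F i| <= 'C(n.-1, k.-1) ->
  'C(#|star F i| + #|cA|, t)
    <= 'C(#|star F i|, t) + #|[set G in intfam F t | G :&: cA != set0]|.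
Proof.
move=> k0 [uF cF maxF] sAF niA room.
have [cB sB cardB] : exists2 cB : {set {set 'I_n}},
    cB \subset hitting k [set i] :\: F & #|cB| = #|cA|.
  apply: subset_of_card; rewrite cardsD card_hitting1 //.
  have : #|hitting k [set i] :&: F| <= #|star F i|.
    apply/subset_leq_card/subsetP => A; rewrite in_setI hitting1E inE.
    by case/andP=> /andP[_ ->] ->.
  by lia.
have Bin A : A \in cB -> [/\ #|A| == k, i \in A & A \notin F].
  by move/(subsetP sB); rewrite in_setD hitting1E => /andP[-> /andP[-> ->]].
have disB : [disjoint F & cB].
  by rewrite disjoint_sym; apply/pred0Pn => -[A /andP[/= /Bin[_ _ /negP nF]]].
pose F' := (F :\: cA) :|: cB.
have uF' : uniform k F'.
  by move=> A; rewrite !inE => /orP[/andP[_ /uF]|/Bin[/eqP]].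
have cF' : #|F'| = m.
  rewrite cardsU (_ : _ :&: _ = set0) ?cards0; last first.
    apply/eqP; rewrite setI_eq0; apply: disjointWl disB; exact: subsetDl.
  by rewrite cardsDS // cardB subn0 subnK // subset_leq_card.
pose W := star F i :|: cB.
have cW : #|W| = #|star F i| + #|cA|.
  rewrite cardsU (_ : _ :&: _ = set0) ?cards0 ?subn0 ?cardB //.
  apply/eqP; rewrite setI_eq0; apply: disjointWl disB.
  by apply/subsetP => A; rewrite inE => /andP[].
have iW A : A \in W -> i \in A.
  by rewrite !inE => /orP[/andP[]|/Bin[]].
(* The subfamilies common to F and F', and all those in the enlarged star. *)
pose stay := intfam (F :\: cA) t.
pose new := [set G : {set {set 'I_n}} | (G \subset W) && (#|G| == t)].
have sub' : stay :|: new \subset intfam F' t.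
  apply/subsetP => G; rewrite !inE => /orP[/and3P[GF -> ->]|/andP[GW ->]].
    by rewrite (subset_trans GF) ?subsetUl.
  apply/andP; split.
    apply: subset_trans GW _; apply/subsetP => A; rewrite !inE.
    case/orP=> [/andP[-> iA]|->]; last by rewrite orbT.
    by rewrite andbT; apply/orP; left; apply/negP => /niA; rewrite iA.
  apply/forallP => A; apply/implyP => AG; apply/forallP => B; apply/implyP => BG.
  by apply/set0Pn; exists i; rewrite inE !iW ?(subsetP GW).
have old : #|stay :&: new| <= 'C(#|star F i|, t).
  rewrite -cards_draws; apply/subset_leq_card/subsetP => G; rewrite !inE.
  case/andP=> /and3P[GF -> _] /andP[GW _]; rewrite andbT.
  apply/subsetP => A AG; move/(subsetP GW): (AG); rewrite [A \in W]inE => /orP[//|/Bin[_ _]].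
  by move/(subsetP GF): AG; rewrite inE => /andP[_ ->].
have splitF : #|intfam F t| <= #|[set G in intfam F t | G :&: cA != set0]| + #|stay|.
  rewrite -(cardsID [set G : {set {set 'I_n}} | G :&: cA != set0] (intfam F t)).
  rewrite leq_add // subset_leq_card //; apply/subsetP => G; rewrite !inE ?negbK.
    by case/andP=> -> ->.
  by case/andP=> meet /and3P[GF -> ->]; rewrite subsetD GF -setI_eq0 meet.
have le1 : #|intfam F' t| <= #|intfam F t| by exact: maxF.
have cnew : #|new| = 'C(#|star F i| + #|cA|, t) by rewrite cards_draws cW.
have := subset_leq_card sub'; have := cardsUI stay new; rewrite cnew => eqUI le2.
rewrite -(leq_add2l #|stay|) -eqUI.
have := leq_add (leq_trans (leq_trans le2 le1) splitF) old; clear; lia.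
Qed.

(** * Intersecting subfamilies outside the stars *)

(** The intersecting t-subfamilies through A that are contained in no star. *)
Definition spread (n : nat) (F : {set {set 'I_n}}) (t : nat) (A : {set 'I_n}) :=
  [set G in intfam F t | (A \in G) && [forall x, exists B in G, x \notin B]].

(** Here m stands for the size of F and M for a bound on the number of k-sets
    that meet a set of 3k points at least twice. The first term counts subfamilies
    whose members other than A all meet A twice; the second one counts, for
    t >= 3, the choices of two further members B and B' and of the rest. *)
Definition spread_bound (m M t : nat) : nat :=
  'C(M, t - 1) + (2 < t) * (m * (M * 'C(M, t - 3))).

Lemma card_intfam_at (n t : nat) (F : {set {set 'I_n}}) (A : {set 'I_n}) :
  A \in F ->
  #|[set G in intfam F t | A \in G]|
    <= \sum_(x in A) 'C(#|star F x| - 1, t - 1) + #|spread F t A|.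
Proof.
move=> AF.
pose E x := [set G : {set {set 'I_n}} |
  [&& [set A] \subset G, G \subset star F x & #|G| == t]].
apply: (@leq_trans (#|\bigcup_(x in A) E x| + #|spread F t A|)).
  apply: leq_trans (leq_card_setU _ _).1; apply/subset_leq_card/subsetP => G.
  rewrite inE => /andP[GF AG]; rewrite inE orbC [_ \in spread _ _ _]inE GF AG /=.
  case: (boolP [forall x, _]) => //= /forallPn[x /existsPn nx].
  have Gx B : B \in G -> x \in B by move=> BG; have := nx B; rewrite BG /= negbK.
  apply/bigcupP; exists x; first exact: Gx.
  move: GF; rewrite !inE sub1set AG => /and3P[GF -> _]; rewrite /= andbT.
  by apply/subsetP => B BG; rewrite inE (subsetP GF) // Gx.
rewrite leq_add2r; apply: leq_trans (leq_card_bigcup_sum _ _) _.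
apply: leq_sum => x _; rewrite -(cards1 A); exact: card_between.
Qed.

Lemma multimeetI (n k : nat) (U C : {set 'I_n}) (x y : 'I_n) :
  #|C| = k -> x \in C -> y \in C -> x \in U -> y \in U -> x != y ->
  C \in multimeet k U.
Proof.
move=> cC xC yC xU yU xy; rewrite inE cC eqxx; apply/card_gt1P.
by exists x, y; rewrite !inE xC yC.
Qed.

(** If some B in G meets A in a single point y, take B' in G that misses y. A member
    of G that misses y meets A and B in different points, since y is their only
    common one; this applies to B' as well. A member of G through y has a further
    point in B'. *)
Lemma spread_structure (n k t : nat) (F G : {set {set 'I_n}}) (A : {set 'I_n}) :
  uniform k F -> G \in spread F t A ->
  G \subset A |: multimeet k A \/
  exists B B' : {set 'I_n},
    [/\ [/\ B \in G, B' \in G & B != A], [/\ B' != A & B' != B],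
        B' \in multimeet k (A :|: B) &
        G \subset multimeet k (A :|: B :|: B')].
Proof.
move=> uF; rewrite inE => /andP[]; rewrite inE => /and3P[GF _ /forallP intG] /andP[AG /forallP noC].
have cG C : C \in G -> #|C| = k by move/(subsetP GF)/uF.
have meet C D : C \in G -> D \in G -> exists2 x, x \in C & x \in D.
  move=> CG DG; have := intG C; rewrite CG => /forallP/(_ D); rewrite DG /=.
  by case/set0Pn=> x; rewrite inE => /andP[]; exists x.
case: (boolP (G \subset _)) => [|/subsetPn[B BG]]; [by left | move=> nB; right; move: nB].
rewrite !inE cG // eqxx /= negb_or -leqNgt => /andP[nBA le1].
have [y yA yB] := meet A B AG BG.
have only z : z \in A -> z \in B -> z = y.
  move=> zA zB; apply/eqP; apply: contraLR le1 => zy; rewrite -ltnNge.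
  by apply/card_gt1P; exists z, y; rewrite !inE zA zB yA yB.
have two C : C \in G -> y \notin C -> exists z w,
    [/\ z \in A, w \in B, z \in C, w \in C & z != w].
  move=> CG nyC; have [z zC zA] := meet C A CG AG; have [w wC wB] := meet C B CG BG.
  exists z, w; split=> //; apply: contraNneq nyC => zw.
  by rewrite -(only z) // zw.
have /existsP[B' /andP[BG' nyB']] := noC y.
exists B, B'; split.
- by [].
- by split; apply: contraNneq nyB' => ->.
- have [z [w [zA wB zC wC zw]]] := two B' BG' nyB'.
  by apply: (multimeetI (cG _ BG') zC wC) => //; rewrite inE ?zA ?wB ?orbT.
apply/subsetP => C CG; case: (boolP (y \in C)) => [yC|nyC].
  have [v vC vB'] := meet C B' CG BG'.
  apply: (multimeetI (cG _ CG) yC vC); rewrite ?inE ?yA ?vB' ?orbT //.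
  by apply: contraNneq nyB' => ->.
have [z [w [zA wB zC wC zw]]] := two C CG nyC.
by apply: (multimeetI (cG _ CG) zC wC) => //; rewrite !inE ?zA ?wB ?orbT.
Qed.

(** Combine [spread_structure] with the bound on [multimeet]. The three sets A, B
    and B' have at most 3k points in total, whence the constant 9 k^2. The factor
    #|F| for B is affordable because B' has only O(L) choices: together they are
    fewer than the pairs of sets in a star by a factor of order n. *)
Lemma card_spread (n k t : nat) (F : {set {set 'I_n}}) (A : {set 'I_n}) :
  uniform k F -> A \in F ->
  #|spread F t A| <= spread_bound #|F| (9 * k ^ 2 * 'C(n - 2, k - 2)) t.
Proof.
move=> uF AF; set M := 9 * _ * _.
have leM (U : {set 'I_n}) : #|U| <= 3 * k -> #|@multimeet n k U| <= M.
  move=> cU; apply: leq_trans (card_multimeet k U) _.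
  by rewrite /M leq_mul2r; apply/orP; right; nia.
pose E1 := [set G : {set {set 'I_n}} |
  [&& [set A] \subset G, G \subset A |: multimeet k A & #|G| == t]].
pose P B B' : {set {set 'I_n}} := B' |: [set B; A].
pose E2 B B' := [set G : {set {set 'I_n}} |
  [&& P B B' \subset G, G \subset P B B' :|: multimeet k (A :|: B :|: B') & #|G| == t]].
pose Z1 := [set B in F | B != A].
pose Z2 B := [set B' in F | [&& B' \in multimeet k (A :|: B), B' != A & B' != B]].
pose U2 := \bigcup_(B in Z1) \bigcup_(B' in Z2 B) E2 B B'.
(* A, B and B' are distinct, which also rules out this case when t <= 2. *)
have cP B B' : B \in Z1 -> B' \in Z2 B -> #|P B B'| = 3.
  rewrite !inE => /andP[_ BA] /and4P[_ _ B'A B'B].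
  by rewrite cardsU1 cards2 BA !inE (negPf B'A) (negPf B'B).
have cover : spread F t A \subset E1 :|: U2.
  apply/subsetP => G Gsp; rewrite inE.
  have := Gsp; rewrite inE => /andP[]; rewrite inE => /and3P[GF cG _] /andP[AG _].
  case: (spread_structure uF Gsp) => [GA|[B [B' [[BG B'G BA] [B'A B'B] B'm GU]]]].
    by rewrite inE sub1set AG GA cG.
  apply/orP; right; apply/bigcupP; exists B; first by rewrite inE (subsetP GF).
  apply/bigcupP; exists B'; first by rewrite inE (subsetP GF) // B'm B'A B'B.
  rewrite inE cG (subset_trans GU (subsetUr _ _)) !andbT.
  by apply/subsetP => C; rewrite !inE => /or3P[]/eqP->.
have cA := uF A AF.
apply: leq_trans (subset_leq_card cover) _.
apply: leq_trans (leq_card_setU _ _).1 _; apply: leq_add.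
  apply: leq_trans (card_between _ _ _) _; rewrite cards1; apply: leq_bin2l.
  have := leM A; rewrite cA => /(_ (leq_pmull _ _)) => /(_ isT).
  by rewrite cardsU1; lia.
have [t2|t2] := ltnP 2 t; rewrite ?mul0n ?mul1n.
  apply: leq_card_bigcup => [|B BZ].
    by apply/subset_leq_card/subsetP => B; rewrite inE => /andP[].
  have cB : #|B| = k by apply: uF; move: BZ; rewrite inE => /andP[].
  have leAB : #|A :|: B| <= 2 * k.
    by apply: leq_trans (leq_card_setU _ _).1 _; rewrite cA cB; lia.
  apply: leq_card_bigcup => [|B' B'Z].
    apply: (@leq_trans #|multimeet k (A :|: B)|); last by apply: leM; lia.
    by apply/subset_leq_card/subsetP => B'; rewrite inE => /and4P[].
  have cB' : #|B'| = k by apply: uF; move: B'Z; rewrite inE => /andP[].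
  apply: leq_trans (card_between _ _ _) _; rewrite (cP B B') //; apply: leq_bin2l.
  have : #|multimeet k (A :|: B :|: B')| <= M.
    by apply: leM; apply: leq_trans (leq_card_setU _ _).1 _; rewrite cB'; lia.
  have := (leq_card_setU (P B B') (multimeet k (A :|: B :|: B'))).1.
  by rewrite (cP B B') //; lia.
rewrite leqn0 cards_eq0; apply/set0Pn => -[G /bigcupP[B BZ /bigcupP[B' B'Z]]].
rewrite inE => /and3P[/subset_leq_card PG _ /eqP cG].
by move: PG; rewrite (cP B B') // cG ltnNge t2.
Qed.

(** The second term of the bound has t - 3 free choices among M sets; two more
    choices among the other D - M sets turn it into part of C(D, t-1), and
    there are at least D^2/16 such pairs. *)
Lemma spread_bound_small (m M D t : nat) :
  1 < t -> 2 * M <= D -> 4 <= D ->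
  spread_bound m M t * D ^ 2 <= (M * D + 16 * (m * M)) * 'C(D, t - 1).
Proof.
move=> t1 MD D4; rewrite /spread_bound mulnDl mulnDl leq_add //.
  have := @bin_scale M D (t - 1) ltac:(lia) ltac:(lia).
  move: 'C(M, _) 'C(D, _) => u v uv.
  by rewrite -mulnn mulnA mulnAC leq_mul2r uv orbT.
have [t2|_] := ltnP 2 t; last by rewrite mul0n.
rewrite mul1n.
have := leq_mul_bin M (D - M) (t - 3) 2.
rewrite subnKC; last by lia.
rewrite (_ : t - 3 + 2 = t - 1); last by lia.
have DM : D ^ 2 <= 16 * 'C(D - M, 2).
  have sq := @bin2_ge (D - M) ltac:(lia).
  apply: (@leq_trans (4 * (D - M) ^ 2)); last by lia.
  have : D <= 2 * (D - M) by lia.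
  by move: (D - M) => x; nia.
move: 'C(M, _) 'C(D, _) 'C(D - M, 2) DM => u v w DM uwv.
rewrite (_ : m * (M * u) * D ^ 2 = m * M * (u * D ^ 2)); last by nia.
rewrite (_ : 16 * (m * M) * v = m * M * (16 * v)); last by nia.
rewrite leq_mul2l; apply/orP; right.
apply: (@leq_trans (u * (16 * w))); first by rewrite leq_mul2l DM orbT.
by lia.
Qed.

(** Summed over all members of F, spread subfamilies are less than half of C(N, t).
    One factor N is gained by comparing with H = N/2: since C(H, t-1) is the
    least increment between H and N, it satisfies H C(H, t-1) <= C(N, t). *)
Lemma total_spread_small (m M N l t : nat) :
  1 < t -> m <= l.+1 * N -> 9 <= N ->
  24 * (l.+1 * (49 + 48 * l) * M) <= N ->
  2 * (m * spread_bound m M t) <= 'C(N, t).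
Proof.
move=> t1 mN N9 MN; pose H := N./2.
have [H4 HN NH] : [/\ 4 <= H, H + H <= N & N <= 3 * H].
  by rewrite /H; split; lia.
have bH : H * 'C(H, t - 1) <= 'C(N, t).
  have := bin_addS_ge H H (t - 1); rewrite -addn1 subnK; last by lia.
  by have := leq_bin2l t HN; lia.
apply: leq_trans bH.
set c := l.+1 * (49 + 48 * l).
have Hc : 6 * (c * M) <= H by rewrite /c; lia.
have MH : 2 * M <= H.
  by apply: leq_trans Hc; rewrite /c; nia.
have := @spread_bound_small m M H t t1 MH H4.
move: (spread_bound m M t) 'C(H, t - 1) => sb p small.
have mH : m <= 3 * l.+1 * H by nia.
rewrite -(@leq_pmul2r (H ^ 2)); last by nia.
apply: (@leq_trans (2 * (m * ((M * H + 16 * (m * M)) * p)))); first by nia.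
have mid : (M * H + 16 * (m * M)) <= (49 + 48 * l) * (M * H) by nia.
apply: (@leq_trans (2 * ((3 * l.+1 * H) * ((49 + 48 * l) * (M * H) * p)))).
  by rewrite leq_mul2l leq_mul // leq_mul.
rewrite (_ : 2 * _ = 6 * (c * M) * (H ^ 2 * p)); last by rewrite /c; nia.
rewrite (_ : H * p * H ^ 2 = H * (H ^ 2 * p)); last by nia.
by rewrite leq_mul2r Hc orbT.
Qed.

(** The form used below: for D of order N the spread subfamilies through one set
    are an O(M/N) fraction of C(D, t-1). *)
Lemma spread_bound_rel (m M N D c l t : nat) :
  1 < t -> m <= l.+1 * N -> N <= c * D -> 2 * M <= D -> 4 <= D ->
  N * spread_bound m M t <= c * (1 + 16 * (l.+1 * c)) * M * 'C(D, t - 1).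
Proof.
move=> t1 mN ND MD D4; have := @spread_bound_small m M D t t1 MD D4.
move: (spread_bound m M t) 'C(D, t - 1) => sb p small.
rewrite -(@leq_pmul2r D); last by lia.
apply: (@leq_trans (c * (sb * D ^ 2))).
  by rewrite (_ : c * _ = c * D * sb * D) ?leq_mul //; nia.
rewrite (_ : _ * p * D = c * ((1 + 16 * (l.+1 * c)) * (M * D) * p)); last by nia.
rewrite leq_mul2l; apply/orP; right; apply: leq_trans small _.
rewrite leq_mul2r; apply/orP; right.
have : m <= l.+1 * c * D.
  by apply: leq_trans mN _; rewrite -mulnA leq_mul2l ND orbT.
by move: (l.+1 * c) => x; nia.
Qed.

(** * The largest non-full star *)

Definition full_centres (n k : nat) (F : {set {set 'I_n}}) : {set 'I_n} :=
  [set x | #|star F x| == 'C(n.-1, k.-1)].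

Lemma exchange_degree (n k m t b : nat) (F cA : {set {set 'I_n}}) (i : 'I_n) :
  0 < k -> maximises_int k m t F -> cA \subset F ->
  (forall A, A \in cA -> i \notin A) ->
  #|cA| + #|star F i| <= 'C(n.-1, k.-1) ->
  (forall A, A \in cA -> #|[set G in intfam F t | A \in G]| <= b) ->
  'C(#|star F i| + #|cA|, t) <= 'C(#|star F i|, t) + #|cA| * b.
Proof.
move=> k0 maxF sAF niA room leb.
apply: leq_trans (exchange k0 maxF sAF niA room) _; rewrite leq_add2l.
apply: leq_trans (leq_card_bigcup (leqnn _) leb).
apply/subset_leq_card/subsetP => G; rewrite inE => /andP[GF /set0Pn[A]].
rewrite inE => /andP[AG AcA]; apply/bigcupP; exists A => //.
by rewrite inE GF.
Qed.

(** Let T consist of i and the full centres. The k-sets hitting T are at most m in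
    number, and those missing from F all contain i; so F has at least as many
    members avoiding T as it lacks sets through i. *)
Lemma swappable (n k l m : nat) (F : {set {set 'I_n}}) (i : 'I_n) :
  0 < k -> uniform k F -> #|F| = m -> #|full_centres k F| < l ->
  'C(n, k) - 'C(n - l, k) <= m ->
  exists cA : {set {set 'I_n}}, [/\ cA \subset F,
    #|cA| = 'C(n.-1, k.-1) - #|star F i| &
    forall A x, A \in cA -> x \in A -> (x != i) && (x \notin full_centres k F)].
Proof.
move=> k0 uF cF fl mlow; pose T := i |: full_centres k F.
have cT : #|T| <= l by rewrite cardsU1; apply: leq_trans fl; rewrite -add1n leq_add2r leq_b1.
have cH : #|hitting k T| <= m.
  apply: leq_trans mlow; rewrite card_hitting leq_sub2l // leq_bin2l //.
  by rewrite leq_sub2l.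
have [cA sA cardA] : exists2 cA : {set {set 'I_n}},
    cA \subset F :\: hitting k T & #|cA| = 'C(n.-1, k.-1) - #|star F i|.
  apply: subset_of_card; rewrite -(card_hitting1 i k0).
  have sub1 : hitting k [set i] :|: (F :&: hitting k T) \subset hitting k T.
    rewrite subUset subsetIr andbT; apply/subsetP => A; rewrite hitting1E inE.
    by case/andP=> -> iA; apply/set0Pn; exists i; rewrite !inE iA eqxx.
  have sub2 : hitting k [set i] :&: (F :&: hitting k T) \subset star F i.
    apply/subsetP => A; rewrite in_setI hitting1E in_setI [A \in star _ _]inE.
    by case/andP=> /andP[_ ->] /andP[->].
  have := cardsUI (hitting k [set i]) (F :&: hitting k T).
  have := subset_leq_card sub1; have := subset_leq_card sub2.
  have := cardsID (hitting k T) F; rewrite cF; move: cH; clear; lia.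
exists cA; split=> //; first exact: subset_trans sA (subsetDl _ _).
move=> A x /(subsetP sA); rewrite inE => /andP[nH AF] xA.
have: x \notin T.
  apply: contra nH => xT; rewrite inE uF // eqxx; apply/set0Pn; exists x.
  by rewrite inE xA.
by rewrite !inE negb_or.
Qed.

(** Fill the star of i with the sets provided by [swappable]. All removed sets avoid
    the full centres, so that the loss is at most the sum of C(d(x), t) over all
    x with a non-full star, up to spread subfamilies. As d(x) <= D and the degrees
    sum up to k m, this sum is at most (k m / D) C(D, t). On the other hand, t >= 2
    gives C(D, t) <= (D/N)^2 C(N, t), and the gain of C(N, t) - C(D, t) would win
    for small D / N. *)
Lemma max_degree_large (n k l m t : nat) (F : {set {set 'I_n}}) (i : 'I_n) :
  let N := 'C(n.-1, k.-1) in let L := 'C(n - 2, k - 2) in let D := #|star F i| in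
  0 < k -> maximises_int k m t F -> #|full_centres k F| < l ->
  'C(n, k) - 'C(n - l, k) <= m -> m <= l.+1 * N -> 1 < t <= N ->
  9 <= N -> 24 * (l.+1 * (49 + 48 * l) * (9 * k ^ 2 * L)) <= N ->
  (forall x, x \notin full_centres k F -> #|star F x| <= D) ->
  0 < 'C(D, t) /\ N <= 2 * (1 + k * l.+1) * D.
Proof.
move=> N L D k0 maxF fl mlow mN /andP[t1 tN] N9 large maxD.
have [uF cF _] := maxF.
have [cA [sAF cardA outA]] := swappable i k0 uF cF fl mlow.
have DN : D <= N by exact: card_star_le.
have niA A : A \in cA -> i \notin A.
  by move=> AcA; apply/negP => /(outA _ _ AcA); rewrite eqxx.
have exch := @exchange n k m t F cA i k0 maxF sAF niA.
rewrite cardA -/D -/N subnKC // subnK // in exch; have {}exch := exch (leqnn N).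
pose S := \sum_(x in ~: full_centres k F) 'C(#|star F x|, t).
pose sb := spread_bound m (9 * k ^ 2 * L) t.
have meetS : #|[set G in intfam F t | G :&: cA != set0]| <= S + m * sb.
  pose E x := [set G : {set {set 'I_n}} | (G \subset star F x) && (#|G| == t)].
  apply: (@leq_trans (#|\bigcup_(x in ~: full_centres k F) E x| +
                      #|\bigcup_(A in F) spread F t A|)); last first.
    apply: leq_add.
      apply: leq_trans (leq_card_bigcup_sum _ _) _.
      by apply: leq_sum => x _; rewrite cards_draws.
    apply: leq_card_bigcup => [|A AF]; first by rewrite cF.
    by rewrite /sb -cF; exact: card_spread.
  apply: leq_trans (leq_card_setU _ _).1; apply/subset_leq_card/subsetP => G.
  rewrite inE => /andP[GF /set0Pn[A]]; rewrite inE => /andP[AG AcA].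
  rewrite inE orbC; case: (boolP [forall x, exists B in G, x \notin B]) => sp.
    by apply/orP; left; apply/bigcupP; exists A; rewrite ?(subsetP sAF) // inE GF AG.
  have /forallPn[x /existsPn nx] := sp; apply/orP; right.
  have Gx B : B \in G -> x \in B by move=> BG; have := nx B; rewrite BG /= negbK.
  have /andP[_ nf] := outA _ _ AcA (Gx _ AG).
  apply/bigcupP; exists x; first by rewrite inE.
  move: GF; rewrite !inE => /and3P[GF -> _]; rewrite andbT.
  by apply/subsetP => B BG; rewrite inE (subsetP GF) // Gx.
have sbN := @total_spread_small m (9 * k ^ 2 * L) N l t t1 mN N9 large.
(* Half of C(N, t) absorbs the spread subfamilies. *)
have key : 'C(N, t) <= 2 * ('C(D, t) + S) by rewrite -/sb in sbN; lia.
have DS : D * S <= k * m * 'C(D, t).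
  rewrite -cF -(sum_star uF) big_distrr /= big_distrl /=.
  rewrite [leqRHS](bigID (fun x => x \in ~: full_centres k F)) /=.
  apply: leq_trans (leq_addr _ _); apply: leq_sum => x; rewrite inE => /maxD xD.
  by rewrite mulnC bin_scale // ltnW.
have CN : 0 < 'C(N, t) by rewrite bin_gt0.
have D0 : 0 < D.
  rewrite lt0n; apply: contraTneq key => D0; rewrite -ltnNge.
  rewrite D0 bin0n (_ : t == 0 = false) ?add0n; last by lia.
  rewrite /S big1 ?muln0 // => x; rewrite inE => /maxD; rewrite D0 leqn0 => /eqP->.
  by rewrite bin0n; case: (t) t1.
have ND : N <= 2 * (1 + k * l.+1) * D.
  have sq := bin_scale2 t1 DN.
  have step : D * 'C(N, t) <= 2 * (1 + k * l.+1) * N * 'C(D, t).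
    apply: (@leq_trans (2 * (D * 'C(D, t) + k * m * 'C(D, t)))).
      by rewrite -[2 * _]mulnC; apply: leq_trans (leq_mul (leqnn D) key) _; lia.
    rewrite -mulnDl mulnA leq_mul2r -mulnA leq_mul2l; apply/orP; right.
    by rewrite mulnDl mul1n leq_add // -mulnA leq_mul2l mN orbT.
  have two : D * 'C(N, t) * N ^ 2 <= 2 * (1 + k * l.+1) * N * (D ^ 2 * 'C(N, t)).
    apply: leq_trans (leq_mul step (leqnn (N ^ 2))) _.
    by rewrite -[leqLHS]mulnA leq_mul2l sq orbT.
  have pos : 0 < D * 'C(N, t) * N by rewrite !muln_gt0 D0 CN; lia.
  rewrite -(leq_pmul2l pos); apply: leq_trans (leq_trans two _).
    by rewrite -mulnA mulnn.
  by apply: eq_leq; move: (2 * _) => c; nia.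
split=> //; rewrite lt0n; apply: contraTneq key => C0.
rewrite -ltnNge C0 add0n (_ : S = 0) ?muln0 //.
move: DS; rewrite C0 muln0 leqn0 muln_eq0 => /orP[/eqP D0'|/eqP//].
by move: D0; rewrite D0'.
Qed.

(** * Heavy points *)

Definition heavy (n k D : nat) (F : {set {set 'I_n}}) : {set 'I_n} :=
  [set x | D <= 2 * k * #|star F x|].

(** A member A without heavy points lies in at most k C(D/2k, t-1) <= C(D, t-1)/2
    subfamilies contained in stars, whereas a set added to the star of i would lie
    in C(D, t-1). *)
Lemma heavy_cover (n k l m t c : nat) (F : {set {set 'I_n}}) (i : 'I_n) :
  let N := 'C(n.-1, k.-1) in let M := 9 * k ^ 2 * 'C(n - 2, k - 2) in
  let D := #|star F i| in
  0 < k -> maximises_int k m t F -> D < N -> 1 < t -> 0 < 'C(D, t - 1) ->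
  N <= c * D -> m <= l.+1 * N -> 2 * M <= D -> 4 <= D ->
  2 * (c * (1 + 16 * (l.+1 * c)) * M) < N ->
  forall A, A \in F -> exists2 x, x \in heavy k D F & x \in A.
Proof.
move=> N M D k0 maxF DN t1 p0 ND mN MD D4 large A AF.
have [uF cF _] := maxF; have cA := uF A AF.
have rel := @spread_bound_rel m M N D c l t t1 mN ND MD D4.
have [/pred0Pn[x /andP[/= xH xA]]|light] := boolP (~~ [disjoint heavy k D F & A]).
  by exists x.
exfalso; move/negPn: light => light.
have lightx x : x \in A -> 2 * k * #|star F x| < D.
  move=> xA; rewrite ltnNge; apply/negP => xH.
  by move: light => /pred0P/(_ x); rewrite /= xA inE xH.
have niA B : B \in [set A] -> i \notin B.
  rewrite inE => /eqP ->; apply/negP => /lightx; rewrite -/D; nia.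
have sA : [set A] \subset F by rewrite sub1set.
have room : #|[set A]| + #|star F i| <= N by rewrite cards1.
have bnd B : B \in [set A] ->
    #|[set G in intfam F t | B \in G]|
      <= \sum_(x in A) 'C(#|star F x| - 1, t - 1) + spread_bound m M t.
  rewrite inE => /eqP ->; apply: leq_trans (card_intfam_at _ AF) _.
  by rewrite leq_add2l /M -cF card_spread.
have := exchange_degree k0 maxF sA niA room bnd.
rewrite -/D cards1 mul1n addn1 -[t in 'C(D.+1, t)](@subnK 1) ?addn1; last by lia.
rewrite binS -addn1 subnK ?leq_add2l; last by lia.
have : 2 * \sum_(x in A) 'C(#|star F x| - 1, t - 1) <= 'C(D, t - 1).
  rewrite -(@leq_pmul2l k) // mulnA [k * 2]mulnC big_distrr /= -{2}cA -sum_nat_const.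
  apply: leq_sum => x xA; have xD := lightx x xA.
  have le1 : 'C(#|star F x| - 1, t - 1) <= 'C(#|star F x|, t - 1).
    by apply: leq_bin2l; rewrite leq_subr.
  have := @bin_scale #|star F x| D (t - 1) ltac:(lia) ltac:(nia).
  move: le1; move: 'C(_ - 1, _) 'C(#|_|, _) 'C(D, _) => u v p uv vp.
  rewrite -(@leq_pmul2r D); last by lia.
  apply: (@leq_trans (2 * k * (#|star F x| * p))).
    by rewrite -mulnA leq_mul2l; apply/orP; right; apply: leq_trans vp; rewrite leq_mul2r uv orbT.
  by rewrite mulnA [p * D]mulnC leq_mul2r (ltnW xD) orbT.
move: rel p0; move: (\sum_(x in A) _) (spread_bound _ _ _) 'C(D, _) => S sb p rel p0 S2 pS.
have : p <= 2 * sb by lia.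
by move: rel large; move: (c * _ * M) => e rel large p2; nia.
Qed.

Lemma card_heavy (n k D N c l : nat) (F : {set {set 'I_n}}) :
  uniform k F -> 0 < N -> #|F| <= l.+1 * N -> N <= c * D ->
  #|heavy k D F| <= 2 * k * c * (k * l.+1).
Proof.
move=> uF N0 mN ND; rewrite -(@leq_pmul2r N) // -sum_nat_const.
apply: (@leq_trans (\sum_(x in heavy k D F) c * (2 * k) * #|star F x|)).
  apply: leq_sum => x; rewrite inE => xH; apply: leq_trans ND _.
  by rewrite -mulnA leq_mul2l xH orbT.
rewrite -big_distrr /=.
have le1 : \sum_(x in heavy k D F) #|star F x| <= k * (l.+1 * N).
  apply: (@leq_trans (k * #|F|)); last by rewrite leq_mul2l mN orbT.
  by rewrite -(sum_star uF) [leqRHS](bigID (fun x => x \in heavy k D F)) leq_addr.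
apply: leq_trans (leq_mul (leqnn _) le1) _.
by rewrite [c * _]mulnC -!mulnA.
Qed.

(** Each member of F through y contains y and a point of X, hence two points
    of y |: X. *)
Lemma light_star (n k : nat) (F : {set {set 'I_n}}) (X : {set 'I_n}) (y : 'I_n) :
  uniform k F -> (forall A, A \in F -> exists2 x, x \in X & x \in A) ->
  y \notin X -> #|star F y| <= #|X|.+1 ^ 2 * 'C(n - 2, k - 2).
Proof.
move=> uF cov nyX.
apply: (@leq_trans #|multimeet k (y |: X)|); last first.
  by apply: leq_trans (card_multimeet _ _) _; rewrite cardsU1 nyX add1n.
apply/subset_leq_card/subsetP => A; rewrite inE => /andP[AF yA].
have [x xX xA] := cov A AF.
apply: (@multimeetI n k _ A x y) => //; rewrite ?inE ?xX ?eqxx ?orbT //; first exact: uF.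
by apply: contraNneq nyX => <-.
Qed.

(** The sets removed from the star of j have j as their only point in X, so that
    their other points have degree at most Y and contribute only to the error. *)
Lemma exchange_heavy (n k m t Y : nat) (F cA : {set {set 'I_n}}) (X : {set 'I_n}) (i j : 'I_n) :
  let N := 'C(n.-1, k.-1) in let M := 9 * k ^ 2 * 'C(n - 2, k - 2) in
  let D := #|star F i| in
  0 < k -> maximises_int k m t F -> i \in X -> j \in X -> i != j ->
  (forall y, y \notin X -> #|star F y| <= Y) ->
  cA \subset star F j :\: multimeet k X -> #|cA| + D <= N ->
  'C(D + #|cA|, t) <= 'C(D, t) +
    #|cA| * ('C(#|star F j| - 1, t - 1) + (k * 'C(Y, t - 1) + spread_bound m M t)).
Proof.
move=> N M D k0 maxF iX jX ij lightY scA room.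
have [uF cF _] := maxF.
have inA A : A \in cA -> [/\ A \in F, j \in A & forall x, x \in A -> x \in X -> x = j].
  move/(subsetP scA); rewrite inE => /andP[nm]; rewrite inE => /andP[AF jA].
  split=> // x xA xX; apply/eqP; apply: contraNT nm => xj.
  by apply: (multimeetI (uF _ AF) xA jA).
have sAF : cA \subset F by apply/subsetP => A /inA[].
have niA A : A \in cA -> i \notin A.
  by case/inA=> _ _ only; apply: contra ij => /only->.
apply: (exchange_degree k0 maxF sAF niA room) => A /inA[AF jA only].
apply: leq_trans (card_intfam_at _ AF) _; rewrite addnA.
apply: leq_add; last by rewrite /M -cF card_spread.
rewrite (bigD1 j) //= leq_add2l.
apply: (@leq_trans (\sum_(x in A) 'C(Y, t - 1))); last by rewrite sum_nat_const (uF _ AF).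
rewrite [leqRHS](bigD1 j) //=; apply: leq_trans (leq_addl _ _).
apply: leq_sum => x /andP[xA xj]; apply: leq_bin2l.
apply: leq_trans (leq_subr _ _) (lightY x _).
by apply: contra xj => /(only _ xA)->.
Qed.

Lemma bin_convex (D b t : nat) : 0 < t ->
  'C(D, t) + b * ('C(D, t - 1) + 'C(D + b, t - 1)) <= 'C(D + 2 * b, t).
Proof.
case: t => // t _; rewrite subn1 /=.
have := bin_addS_ge D b t; have := bin_addS_ge (D + b) b t.
by rewrite -addnA addnn -mul2n mulnDr; lia.
Qed.

(** The hypothesis says that the error of [exchange_heavy] is a K/D fraction of
    p = C(D, t-1). With one set the gain is p and the loss is at most
    (d(j)/D) p + (K/D) p. With 2b sets the gain is at least b (p + C(D+b, t-1)),
    which is at least 2 b p + (b^2/D) p, and the loss is at most 2 b p + (2 b K/D) p;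
    this fails for b = 2K + 1. *)
Lemma heavy_near (n k m t Y K : nat) (F : {set {set 'I_n}}) (X : {set 'I_n}) (i j : 'I_n) :
  let N := 'C(n.-1, k.-1) in let L := 'C(n - 2, k - 2) in
  let M := 9 * k ^ 2 * L in let D := #|star F i| in
  0 < k -> maximises_int k m t F -> i \in X -> j \in X -> i != j ->
  #|star F j| <= D -> D < N -> 1 < t -> 0 < 'C(D, t - 1) -> 0 < D ->
  (forall y, y \notin X -> #|star F y| <= Y) ->
  D * (k * 'C(Y, t - 1) + spread_bound m M t) <= K * 'C(D, t - 1) ->
  4 * K + 2 + #|multimeet k X| <= #|star F j| ->
  D <= #|star F j| + K /\ N <= D + (4 * K + 1).
Proof.
move=> N L M D k0 maxF iX jX ij djD DN t1 p0 D0 lightY err roomj.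
have pure a : a <= 4 * K + 2 -> exists2 cA : {set {set 'I_n}},
    cA \subset star F j :\: multimeet k X & #|cA| = a.
  move=> aK; apply: subset_of_card.
  have := cardsID (multimeet k X) (star F j).
  have : #|star F j :&: multimeet k X| <= #|multimeet k X|.
    by rewrite subset_leq_card ?subsetIr.
  by move: aK roomj; clear; lia.
have exch cA := @exchange_heavy n k m t Y F cA X i j k0 maxF iX jX ij lightY.
move: err exch; rewrite -/L -/M -/D -/N; set E := k * _ + _ => err exch.
split.
  have [cA sA cardA] := pure 1 ltac:(lia).
  have := exch cA sA; rewrite cardA -/D add1n => /(_ DN).
  rewrite mul1n addn1 -[t in 'C(D.+1, t)](@subnK 1) ?addn1; last by lia.
  rewrite binS -addn1 subnK ?leq_add2l; last by lia.
  have le1 : 'C(#|star F j| - 1, t - 1) <= 'C(#|star F j|, t - 1).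
    by apply: leq_bin2l; rewrite leq_subr.
  have := @bin_scale #|star F j| D (t - 1) ltac:(lia) djD.
  move: le1 err p0; move: 'C(_ - 1, _) 'C(#|star F j|, _) 'C(D, _) => u v p uv err p0 vp pu.
  rewrite -(leq_pmul2r p0) mulnDl.
  apply: (@leq_trans (D * (v + E))); first by rewrite leq_mul2l (leq_trans pu) ?orbT ?leq_add2r.
  by rewrite mulnDr leq_add // mulnC.
rewrite leqNgt; apply/negP => far.
pose b := 2 * K + 1.
have [cA sA cardA] := pure (2 * b) ltac:(rewrite /b; lia).
have := exch cA sA; rewrite cardA -/D => /(_ ltac:(rewrite /b; lia)).
have := @bin_convex D b t ltac:(lia).
have le1 : 'C(#|star F j| - 1, t - 1) <= 'C(D, t - 1).
  by apply: leq_bin2l; rewrite (leq_trans (leq_subr _ _)).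
have := @bin_scale D (D + b) (t - 1) ltac:(lia) (leq_addr _ _).
move: le1 err p0; move: 'C(_ - 1, _) 'C(D, t - 1) 'C(D + b, _) => u p q up err p0 pq.
move=> h1 h2; have {h1 h2} h : p + q <= 2 * (u + E).
  have : b * (p + q) <= b * (2 * (u + E)).
    by rewrite mulnCA mulnA; have := leq_trans h1 h2; rewrite leq_add2l.
  by rewrite leq_pmul2l // /b; lia.
have {}h : q <= p + 2 * E.
  by move: h up; clear; lia.
have bp : b * p <= 2 * (D * E).
  rewrite -(leq_add2l (p * D)) [b * p]mulnC -mulnDr (leq_trans pq) //.
  by rewrite (leq_trans (leq_mul (leqnn D) h)) // mulnDr [D * p]mulnC mulnCA.
have : b * p <= 2 * K * p.
  by apply: leq_trans bp _; rewrite -mulnA leq_mul2l err.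
by rewrite leq_pmul2r // /b addn1 ltnn.
Qed.

(** * Counting the heavy points *)

(** F is contained in the family of k-sets hitting an l-set, and by the lower bound
    on m it is all of it. *)
Lemma full_of_small_cover (n k l m : nat) (F : {set {set 'I_n}}) (X : {set 'I_n}) :
  0 < k -> l <= n -> uniform k F -> #|F| = m -> 'C(n, k) - 'C(n - l, k) <= m ->
  (forall A, A \in F -> exists2 x, x \in X & x \in A) -> #|X| <= l ->
  exists S : {set 'I_n}, #|S| = l /\ (forall i, i \in S -> full_star k F i).
Proof.
move=> k0 ln uF cF mlow cov Xl.
have [P PX cP] : exists2 P : {set 'I_n}, P \subset ~: X & #|P| = l - #|X|.
  by apply: subset_of_card; have := cardsC X; rewrite card_ord; move: ln; clear; lia.
have cS : #|X :|: P| = l.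
  rewrite cardsU cP (_ : X :&: P = set0) ?cards0; first by lia.
  by apply/eqP; rewrite setI_eq0 disjoint_sym disjoints_subset.
exists (X :|: P); split=> // i iS A cA iA.
have sub : F \subset hitting k (X :|: P).
  apply/subsetP => B BF; rewrite inE (uF _ BF) eqxx.
  by have [x xX xB] := cov B BF; apply/set0Pn; exists x; rewrite !inE xX xB.
have /eqP -> : F == hitting k (X :|: P).
  by rewrite eqEcard sub card_hitting cS cF.
by rewrite inE cA eqxx; apply/set0Pn; exists i; rewrite !inE iA -in_setU iS.
Qed.

(** With the notation of the opening comment: N <= ratio D. *)
Definition ratio (k l : nat) : nat := 2 * (1 + k * l.+1).

(** Spread subfamilies through one set number at most cost (L/N) C(D, t-1). *)
Definition cost (k l : nat) : nat :=
  ratio k l * (1 + 16 * (l.+1 * ratio k l)) * (9 * k ^ 2).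

(** Upper bound for the number of heavy points. *)
Definition centres (k l : nat) : nat := 2 * k * ratio k l * (k * l.+1).

(** Take K = slack L in [heavy_near]: the first summand accounts for the points of
    low degree, the second one for the spread subfamilies. *)
Definition slack (k l : nat) : nat := k * (centres k l).+1 ^ 2 + cost k l.

Definition defect (k l : nat) : nat := 5 * slack k l + 1.

(** A sum of all the constants c for which c L <= N is used, so that each of these
    inequalities follows from the one for the sum; see [threshold_le]. *)
Definition threshold (k l : nat) : nat :=
  9 + 24 * (l.+1 * (49 + 48 * l) * (9 * k ^ 2)) + ratio k l * (18 * k ^ 2 + 4)
  + (2 * cost k l + 1) + ratio k l * (centres k l).+1 ^ 2
  + ratio k l * (2 * k) * (4 * slack k l + 2 + (centres k l).+1 ^ 2)
  + (l.+2 * defect k l + k * l.+2 ^ 2 + 1).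

Lemma threshold_le (k l L N : nat) : threshold k l * L <= N ->
  [/\ 9 * L <= N, 24 * (l.+1 * (49 + 48 * l) * (9 * k ^ 2)) * L <= N,
      ratio k l * (18 * k ^ 2 + 4) * L <= N & (2 * cost k l + 1) * L <= N] /\
  [/\ ratio k l * (centres k l).+1 ^ 2 * L <= N,
      ratio k l * (2 * k) * (4 * slack k l + 2 + (centres k l).+1 ^ 2) * L <= N &
      (l.+2 * defect k l + k * l.+2 ^ 2 + 1) * L <= N].
Proof.
rewrite /threshold.
move: (24 * _) (ratio k l * (18 * _ + _)) (2 * cost k l + 1) (ratio k l * _ ^ 2).
move: (ratio k l * _ * _) (l.+2 * _ + _ + 1) => a b c d e f.
by rewrite !mulnDl => big; split; split; apply: leq_trans big; clear; lia.
Qed.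

(** The quantitative dichotomy: almost full stars lack only O(L) sets. There are at
    most l - 1 full centres in the non-trivial case, so more than l heavy points
    include one, other than i, whose star is not full; [heavy_near] applied to it
    shows that D is close to N. *)
Lemma structure (n k l t m : nat) (F : {set {set 'I_n}}) :
  let N := 'C(n.-1, k.-1) in let L := 'C(n - 2, k - 2) in
  0 < k -> l <= n -> 1 < t <= N -> 0 < L -> threshold k l * L <= N ->
  'C(n, k) - 'C(n - l, k) <= m -> m <= 'C(n, k) - 'C(n - l - 1, k) ->
  maximises_int k m t F ->
  (exists S : {set 'I_n}, #|S| = l /\ (forall i, i \in S -> full_star k F i)) \/
  (exists S : {set 'I_n},
     [/\ #|S| = l.+1, forall i, i \in S -> N <= #|star F i| + defect k l * L &
         forall A, A \in F -> exists2 i, i \in S & i \in A]).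
Proof.
move=> N L k0 ln /andP[t1 tN] L0 big mlow mhigh maxF.
have [uF cF _] := maxF.
have starN i : #|star F i| <= N by exact: card_star_le.
have [fl|fl] := leqP l #|full_centres k F|.
  left; have [S sS cS] := subset_of_card fl; exists S; split=> // i /(subsetP sS).
  by rewrite inE => /eqP; exact: full_starP.
have mN : m <= l.+1 * N.
  apply: leq_trans mhigh _; rewrite -subnDA addn1 /N -(prednK k0).
  exact: bin_sub_le.
have [i0 i0f] : exists i, i \notin full_centres k F.
  apply/existsP; rewrite -negb_forall; apply: contraL fl => /forallP allf.
  rewrite -leqNgt (leq_trans ln) // -{1}(card_ord n) -cardsT subset_leq_card //.
  by apply/subsetP => i _.
case: (@arg_maxnP _ i0 (fun i => i \notin full_centres k F) (fun i => #|star F i|) i0f).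
move=> i iF maxi; pose D := #|star F i|.
have {}maxi x : x \notin full_centres k F -> #|star F x| <= D by exact: maxi.
have DN : D < N by rewrite ltn_neqAle starN andbT; move: iF; rewrite inE.
have [[b1 b2 b3 b4] [b5 b6 b7]] := threshold_le big.
have N9 : 9 <= N by apply: leq_trans b1; rewrite leq_pmulr.
have [CD ND] : 0 < 'C(D, t) /\ N <= ratio k l * D.
  apply: (max_degree_large k0 maxF fl mlow mN) => //; first by rewrite t1.
  by rewrite -/L !mulnA in b2 *.
have ratio0 : 0 < ratio k l by rewrite /ratio; lia.
have ltD a : ratio k l * a * L <= N -> a * L <= D.
  by move=> h; rewrite -(leq_pmul2l ratio0) mulnA (leq_trans h).
have bD := ltD _ b3; have YD := ltD _ b5.
have MD : 2 * (9 * k ^ 2 * L) <= D.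
  by apply: leq_trans bD; rewrite mulnA leq_mul2r; apply/orP; right; lia.
have D4 : 4 <= D.
  by apply: leq_trans bD; rewrite mulnDl; apply: leq_trans (leq_addl _ _); rewrite leq_pmulr.
have tD : t <= D by rewrite -bin_gt0.
have p0 : 0 < 'C(D, t - 1) by rewrite bin_gt0; lia.
pose X := heavy k D F.
have cov : forall A, A \in F -> exists2 x, x \in X & x \in A.
  apply: (heavy_cover k0 maxF DN t1 p0 ND mN MD D4).
  rewrite (_ : 2 * _ = 2 * cost k l * L); last by rewrite /cost -/L !mulnA.
  by apply: leq_trans b4; rewrite addn1 mulSn -add1n leq_add2r.
have [Xl|Xl] := leqP #|X| l.
  by left; exact: full_of_small_cover k0 ln uF cF mlow cov Xl.
right.
have iX : i \in X by rewrite inE -/D leq_pmull //; lia.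
have XQ : #|X| <= centres k l.
  by apply: (card_heavy uF _ _ ND); [lia | rewrite cF].
pose Y := (centres k l).+1 ^ 2 * L.
have lightY y : y \notin X -> #|star F y| <= Y.
  move=> nyX; apply: leq_trans (light_star uF cov nyX) _.
  by rewrite leq_mul2r leq_exp2r // ltnS XQ orbT.
have mmX : #|multimeet k X| <= Y.
  apply: leq_trans (card_multimeet k X) _.
  by rewrite leq_mul2r leq_exp2r // (leqW XQ) orbT.
have err : D * (k * 'C(Y, t - 1) + spread_bound m (9 * k ^ 2 * L) t)
    <= slack k l * L * 'C(D, t - 1).
  rewrite mulnDr /slack 2!mulnDl leq_add //.
    apply: (@leq_trans (k * (Y * 'C(D, t - 1)))); last by rewrite /Y !mulnA.
    rewrite mulnCA leq_mul2l [D * _]mulnC; apply/orP; right.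
    by apply: bin_scale => //; lia.
  apply: (@leq_trans (N * spread_bound m (9 * k ^ 2 * L) t)).
    by rewrite leq_mul2r ltnW ?orbT.
  have := @spread_bound_rel m (9 * k ^ 2 * L) N D (ratio k l) l t t1 mN ND MD D4.
  by rewrite mulnA.
have near j : j \in X -> i != j -> j \notin full_centres k F ->
    D <= #|star F j| + slack k l * L /\ N <= D + (4 * (slack k l * L) + 1).
  move=> jX ij jF.
  apply: (heavy_near k0 maxF iX jX ij (maxi j jF) DN t1 p0 _ lightY err); first by lia.
  have kr0 : 0 < 2 * k * ratio k l by rewrite muln_gt0 ratio0 andbT muln_gt0.
  rewrite -(leq_pmul2l kr0).
  apply: (@leq_trans N); last first.
    apply: leq_trans ND _; rewrite [2 * k * _]mulnC -mulnA leq_mul2l.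
    by move: jX; rewrite inE => ->; rewrite orbT.
  apply: leq_trans b6; rewrite [2 * k * _]mulnC -[leqRHS]mulnA leq_mul2l; apply/orP; right.
  move: mmX; rewrite /Y !mulnDl; move: (_ ^ 2 * L) => y; rewrite -mulnA.
  by move: (slack k l * L) L0; clear; lia.
(* Not all heavy points other than i are full centres. *)
have ND' : N <= D + (4 * (slack k l * L) + 1).
  have [j jX jT] : exists2 j, j \in X & j \notin i |: full_centres k F.
    apply/subsetPn; apply: contraL Xl => /subset_leq_card.
    rewrite cardsU1 iF -leqNgt => h; exact: leq_trans h fl.
  move: jT; rewrite in_setU1 negb_or => /andP[ji jF].
  by have [] := near j jX _ jF; rewrite // eq_sym.
have bound j : j \in X -> N <= #|star F j| + defect k l * L.
  move=> jX; rewrite /defect mulnDl mul1n -mulnA.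
  have [->|ij] := eqVneq j i.
    by move: ND' L0; rewrite -/D; clear; lia.
  have [|jF] := boolP (j \in full_centres k F).
    by rewrite inE => /eqP ->; rewrite leq_addr.
  rewrite eq_sym in ij; have [h _] := near j jX ij jF.
  by move: h ND' L0; clear; lia.
exists X; split=> //.
apply/eqP; rewrite eqn_leq Xl andbT leqNgt; apply/negP => Xl2.
(* More than l + 1 heavy points: their stars are too large to fit into F. *)
have [P PX cP] := subset_of_card Xl2.
have lower : l.+2 * N <= \sum_(x in P) #|star F x| + l.+2 * (defect k l * L).
  rewrite -cP -!sum_nat_const -big_split /=.
  by apply: leq_sum => x /(subsetP PX)/bound.
have := sum_star_le P uF; rewrite cF cP -/L => upper.
have : (l.+2 * defect k l + k * l.+2 ^ 2 + 1) * L <= l.+2 * (defect k l * L) + k * (l.+2 ^ 2 * L).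
  apply: leq_trans b7 _; rewrite -(leq_add2l (l.+1 * N)).
  rewrite (_ : l.+1 * N + N = l.+2 * N); last by rewrite [RHS]mulSn addnC.
  apply: leq_trans lower _; rewrite [leqRHS]addnCA [leqLHS]addnC leq_add2l.
  by apply: leq_trans upper _; rewrite leq_add2r.
by rewrite !mulnA -mulnDl leq_pmul2r // addn1 ltnn.
Qed.

(** * The theorem *)

Lemma singletons_full (n l : nat) (F : {set {set 'I_n}}) :
  uniform 1 F -> l <= #|F| ->
  exists S : {set 'I_n}, #|S| = l /\ (forall i, i \in S -> full_star 1 F i).
Proof.
move=> uF lF; pose V := [set x | [set x] \in F].
have FV : F \subset [set [set x] | x in V].
  apply/subsetP => A AF; have /eqP/cards1P[x Ax] := uF A AF.
  by apply/imsetP; exists x => //; rewrite inE -Ax.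
have lV : l <= #|V|.
  exact: leq_trans lF (leq_trans (subset_leq_card FV) (leq_imset_card _ _)).
have [S SV cS] := subset_of_card lV; exists S; split=> // i /(subsetP SV).
rewrite inE => iF A /eqP/cards1P[x ->].
by rewrite inE => /eqP <-.
Qed.

Lemma codegree_degree (n k : nat) : 1 < k -> 0 < n ->
  (n - 1) * 'C(n - 2, k - 2) = (k - 1) * 'C(n.-1, k.-1).
Proof.
case: k n => [|[|k]] // [|n] // _ _.
by rewrite !subSS !subn0 !subn1 /= mul_bin_diag.
Qed.

(* When k >= 2 and l >= 1, the hypothesis t <= 'C(n.-1, k.-1) keeps t within
   the size of a full star: beyond it (n large) no k-uniform family has an
   intersecting subfamily of size t, so every family is a maximiser. *)
Theorem theorem1p4 (R : realType) (k l : nat) (hk : 1 <= k) :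
  exists (n0 : nat) (delta : nat -> R),
    [/\ forall n : nat, (0 <= delta n)%R,
        (delta n @[n --> \oo] --> (0 : R)%R)%classic &
        forall (t n m : nat) (F : {set {set 'I_n}}),
          2 <= t ->
          n0 <= n ->
          (2 <= k -> 1 <= l -> t <= 'C(n.-1, k.-1)) ->
          'C(n, k) - 'C(n - l, k) <= m ->
          m <= 'C(n, k) - 'C(n - l - 1, k) ->
          maximises_int k m t F ->
          (exists S : {set 'I_n},
             #|S| = l /\ (forall i, i \in S -> full_star k F i))
          \/
          (exists S : {set 'I_n},
             [/\ #|S| = l.+1,
                 forall i, i \in S -> almost_full_star (delta n) k F i &
                 forall A, A \in F -> exists2 i, i \in S & i \in A])].
Proof.
have [k1|k1] := leqP k 1.
  have {hk k1} -> : k = 1 by apply/eqP; rewrite eqn_leq k1.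
  exists l, (fun=> 0%R); split=> //; first exact: cvg_cst.
  move=> t n m F _ ln _ mlow _ [uF cF _]; left; apply: singletons_full => //.
  by rewrite cF; apply: leq_trans mlow; rewrite !bin1 subKn.
have [->|l0] := posnP l.
  exists 0, (fun=> 0%R); split=> //; first exact: cvg_cst.
  move=> *; left; exists finset.set0; split; first exact: cards0.
  by move=> i; rewrite in_set0.
(* N <= d + defect L and (n-1) L = (k-1) N give the bound c/(n+1) on the missing
   fraction; the factor 3 comes from n + 1 <= 3 (n - 1). *)
pose c := 3 * (defect k l * k).
exists (threshold k l * k + k + l + 2), (fun n => c%:R * harmonic n)%R; split.
- by move=> n; rewrite mulr_ge0 ?ler0n ?harmonic_ge0.
- have := @cvgMl_tmp R nat \oo%classic _ harmonic c%:R%R 0%R cvg_harmonic.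
  by rewrite mulr0 => lim0; exact: lim0.
move=> t n m F t1 big tN mlow mhigh maxF.
have n0 : 0 < n by lia.
have NL := codegree_degree k1 n0.
have L0 : 0 < 'C(n - 2, k - 2) by rewrite bin_gt0; lia.
have k10 : 0 < k - 1 by lia.
have thr : threshold k l * 'C(n - 2, k - 2) <= 'C(n.-1, k.-1).
  rewrite -(leq_pmul2l k10) -NL mulnA leq_mul2r; apply/orP; right.
  by rewrite mulnC; nia.
have tN' : 1 < t <= 'C(n.-1, k.-1) by rewrite t1 tN.
have ln : l <= n by lia.
have [S|[S [cS near cov]]] := structure hk ln tN' L0 thr mlow mhigh maxF.
  by left.
right; exists S; split=> // i /near; rewrite /almost_full_star.
move: #|star F i| => d dN.
have cN : defect k l * 'C(n - 2, k - 2) * n.+1 <= c * 'C(n.-1, k.-1).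
  apply: (@leq_trans (defect k l * 'C(n - 2, k - 2) * (3 * (n - 1)))).
    by rewrite leq_mul2l; apply/orP; right; lia.
  rewrite /c (_ : _ * (3 * _) = 3 * (defect k l * ((n - 1) * 'C(n - 2, k - 2)))); last by nia.
  rewrite NL !mulnA leq_mul2r; apply/orP; right.
  by rewrite leq_mul2l leq_subr orbT.
rewrite mulrBl mul1r lerBlDr.
apply: (@le_trans _ _ (d%:R + (defect k l * 'C(n - 2, k - 2))%:R)%R).
  by rewrite -natrD ler_nat.
rewrite lerD2l /harmonic /= mulrAC -natrM ler_pdivlMr ?ltr0n //.
by rewrite -natrM ler_nat.
Qed.
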